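(* Let $\ell>0$ and let $V$, $C$, $f^*$, $g^*$ be as defined in the context. Fix $\epsilon\in(0,1)$ and let $$ m^\sharp_\epsilon = \frac{2}{\pi}\left(1-\log(\ell\epsilon)\right). $$ 1. For $x\le m^\sharp_\epsilon$ and $-\frac{\pi}{2}<\theta\le \frac{\pi}{2}$, we have $$ g^*(x,\theta) \le C_1 f^*(x,\theta), $$ where $$ C_1 = C e^{m^\sharp_\epsilon/\ell} = e^{\frac{2}{\pi\ell}\left(1-\log \epsilon\right)}. $$ 2. For $x> m^\sharp_\epsilon$ and $-\frac{\pi}{2}<\theta\le \frac{\pi}{2}$, we have $$ g^*(x,\theta) \le C_{2}\, \frac{1}{\pi}\, e^{-\xi(x-m_\epsilon(\theta))^2/2}\sqrt{\frac{2\xi}{\pi}} , $$ where $$ \xi = \frac{\pi}{2\ell}, \qquad m_\epsilon(\theta) = \frac{2}{\pi}\log\left(\frac{2}{\epsilon \ell\pi V(\theta)}\right),\qquad C_{2} =\frac{\pi\sqrt{\ell}}{2e(1-\epsilon)}\, \epsilon^{-\frac{2}{\pi\ell}} . $$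
   Context: Fix $\ell>0$ (this is the case $\alpha=1$). Define $C = e^{\frac{2}{\ell\pi}\log\ell}=\ell^{\frac{2}{\ell\pi}}$ and $$ V(\theta) = \frac{1-\frac{2}{\pi}\theta}{\cos\theta}\exp\left\{(\theta-\pi/2)\tan\theta\right\}, \qquad \theta\in[-\pi/2,\pi/2], $$ where the endpoint values are understood as the limits $V(-\pi/2)=\infty$ and $V(\pi/2)=\frac{2}{\pi e}$. Define $$ f^*(x,\theta) = \frac{1}{2} e^{\pi x/2}\, V(\theta)\, e^{-e^{\pi x/2} V(\theta)},\qquad x\in\mathbb R,\ -\pi/2<\theta<\pi/2, $$ $f^*(x,\theta)=0$ for other $\theta$, and $$ g^*(x,\theta) = C e^{x/\ell} f^*(x,\theta). $$ *)

(* Defs.v *)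
From Stdlib Require Import Reals.
From Coquelicot Require Import Rbar.
Open Scope R_scope.

(* [Rpower x y] unfolds to [exp (y * ln x)]. *)
Definition Cst (l : R) : R := Rpower l (2 / (l * PI)).

(* The formula degenerates to 0/0 at PI/2 and to 2/0 at -PI/2; there V takes its
   limit values.  Only arguments in [-PI/2, PI/2] are meaningful. *)
Definition V (th : R) : Rbar :=
  if Req_EM_T th (- (PI / 2)) then p_infty
  else if Req_EM_T th (PI / 2) then Finite (2 / (PI * exp 1))
  else Finite ((1 - 2 / PI * th) / cos th * exp ((th - PI / 2) * tan th)).

(* V is finite on ]-PI/2, PI/2], so the coercion [real] loses nothing where
   [V th] is used as a real number below. *)
Definition fstar (x th : R) : R :=
  if Rlt_dec (- (PI / 2)) th then
    if Rlt_dec th (PI / 2) then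
      1 / 2 * exp (PI * x / 2) * real (V th)
        * exp (- (exp (PI * x / 2) * real (V th)))
    else 0
  else 0.

Definition gstar (l x th : R) : R := Cst l * exp (x / l) * fstar x th.

Definition msharp (l eps : R) : R := 2 / PI * (1 - ln (l * eps)).

Definition Cst1 (l eps : R) : R := Cst l * exp (msharp l eps / l).

Definition xi (l : R) : R := PI / (2 * l).

Definition meps (l eps th : R) : R :=
  2 / PI * ln (2 / (eps * l * PI * real (V th))).

Definition Cst2 (l eps : R) : R :=
  PI * sqrt l / (2 * exp 1 * (1 - eps)) * Rpower eps (- (2 / (PI * l))).

(* Main.v *)
Require Import Defs.
From Stdlib Require Import Reals Lra.
From Coquelicot Require Import Rbar Rcomplements ElemFct.
Open Scope R_scope.

(** The closed form of [Cst1] is a computation, and the bound for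
    [x <= msharp l eps] is monotonicity: [gstar l x th] is [fstar x th] times a
    factor that increases with [x], and [fstar] is nonnegative.

    In the Gaussian bound the case [th = PI / 2] is trivial, since [fstar]
    vanishes there.  For [th < PI / 2] put [v = V th], [b = 2 / (PI * l)], [a = b / eps] and
    [u = PI / 2 * (x - meps l eps th)].  The centre [meps] is chosen so that
    [exp (PI * x / 2) * v = a * exp u]; the target Gaussian is then
    [exp (- (b * u ^ 2 / 2))] up to a constant, and
    [gstar] is [1 / 2 * (l * (a / v)) ^ b * exp (b * u) * z * exp (- z)] with
    [z = a * exp u].  Three facts finish the proof.

    - [V th >= 2 / (PI * e)] ([V_lower]).  In terms of [t = PI / 2 - th] this
      says [t / sin t * exp (1 - t * cot t) >= 1], where both factors are at
      least [1] because [t * cos t <= sin t <= t].  It bounds the factor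
      [(l * (a / v)) ^ b] by [(e / eps) ^ b], and it turns the assumption
      [msharp l eps < x] into [0 <= u].
    - The exponential [exp (- z)] is split as
      [exp (- (eps * z)) * exp (- ((1 - eps) * z))].  The second part absorbs
      the factor [z], since [z * exp (- (k * z)) <= 1 / (e * k)].
    - The first part is [exp (- (b * exp u))], and for [u >= 0] the Taylor bound
      [exp u >= 1 + u + u ^ 2 / 2] makes [exp (b * (1 + u) - b * exp u)] at most
      [exp (- (b * u ^ 2 / 2))]: this is where the Gaussian comes from. *)

(** * Elementary inequalities *)

(** The difference [sin t - t * cos t] vanishes at [0] and has derivative
    [t * sin t]. *)
Lemma mul_cos_le_sin (t : R) : 0 < t < PI -> t * cos t <= sin t.
Proof.
  intros Ht.
  destruct (MVT_cor2 (fun s => sin s - s * cos s) (fun s => s * sin s) 0 t)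
    as [c [Hc Hc']]; [lra | | ].
  - intros c _.
    replace (c * sin c) with (cos c - (1 * cos c + c * - sin c)) by ring.
    apply (derivable_pt_lim_minus sin (fun s => s * cos s)).
    + apply derivable_pt_lim_sin.
    + apply (derivable_pt_lim_mult id cos).
      * apply derivable_pt_lim_id.
      * apply derivable_pt_lim_cos.
  - rewrite sin_0 in Hc.
    assert (0 < sin c) by (apply sin_gt_0; lra).
    assert (0 <= c * sin c * (t - 0)) by
      (apply Rmult_le_pos; [apply Rmult_le_pos|]; lra).
    lra.
Qed.

Lemma exp_le (x y : R) : x <= y -> exp x <= exp y.
Proof.
  intros [Hxy | <-]; [apply Rlt_le, exp_increasing, Hxy | apply Rle_refl].
Qed.

Lemma exp_ge_quadratic (u : R) : 0 <= u -> 1 + u + u ^ 2 / 2 <= exp u.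
Proof.
  intros Hu.
  pose proof (exp_ge_taylor u 2 Hu) as H.
  simpl in H. simpl. lra.
Qed.

(** This is [1 + w <= exp w] at [w = k * z - 1]; equality holds at the maximum
    [z = 1 / k]. *)
Lemma mul_exp_opp_le (k z : R) :
  0 < k -> z * exp (- (k * z)) <= 1 / (exp 1 * k).
Proof.
  intros Hk.
  pose proof (exp_ineq1_le (k * z - 1)) as H.
  assert (He : exp (k * z - 1) * exp (- (k * z)) * exp 1 = 1).
  { rewrite <- !exp_plus.
    replace (k * z - 1 + - (k * z) + 1) with 0 by ring. apply exp_0. }
  pose proof (exp_pos (- (k * z))). pose proof (exp_pos 1).
  apply Rmult_le_reg_r with (exp 1 * k); [apply Rmult_lt_0_compat; lra|].
  replace (1 / (exp 1 * k) * (exp 1 * k)) with 1 by (field; lra).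
  apply Rle_trans with (2 := Req_le _ _ He).
  replace (z * exp (- (k * z)) * (exp 1 * k))
    with (k * z * exp (- (k * z)) * exp 1) by ring.
  apply Rmult_le_compat_r; [lra|].
  apply Rmult_le_compat_r; lra.
Qed.

(** A Gamma-type density [z * exp (- z)] with [z = a * exp u] is dominated by a
    Gaussian in [u], even after tilting by [exp (eps * a * (1 + u))].  The
    fraction [eps] of the exponent [- z] pays for the tilt and leaves the
    quadratic term; the fraction [1 - eps] pays for the factor [z]. *)
Lemma tilted_gamma_le_gaussian (eps a u : R) :
  0 < eps < 1 -> 0 < a -> 0 <= u ->
  exp (eps * a * (1 + u)) * (a * exp u * exp (- (a * exp u)))
    <= 1 / (exp 1 * (1 - eps)) * exp (- (eps * a * u ^ 2 / 2)).
Proof.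
  intros He Ha Hu.
  set (z := a * exp u).
  replace (exp (eps * a * (1 + u)) * (z * exp (- z))) with
    (z * exp (- ((1 - eps) * z)) * exp (eps * a * (1 + u) - eps * z)).
  - assert (0 < z) by (apply Rmult_lt_0_compat; [lra | apply exp_pos]).
    apply Rmult_le_compat.
    + apply Rmult_le_pos; [lra | apply Rlt_le, exp_pos].
    + apply Rlt_le, exp_pos.
    + apply mul_exp_opp_le; lra.
    + assert (0 <= eps * a) by (apply Rmult_le_pos; lra).
      pose proof (Rmult_le_compat_l _ _ _ H0 (exp_ge_quadratic u Hu)) as Hq.
      apply exp_le.
      unfold z. lra.
  - replace (exp (eps * a * (1 + u)) * (z * exp (- z)))
      with (z * (exp (eps * a * (1 + u)) * exp (- z))) by ring.
    rewrite Rmult_assoc, <- !exp_plus. do 2 f_equal. ring.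
Qed.

(** * Bounds on V and fstar *)

(** With [t = PI / 2 - th] the claim reads
    [t / sin t * exp (1 - t * cot t) >= 1], and each factor is at least [1]. *)
Lemma V_lower (th : R) :
  - (PI / 2) < th < PI / 2 -> 2 / (PI * exp 1) <= real (V th).
Proof.
  intros Hth.
  unfold V.
  destruct (Req_EM_T th (- (PI / 2))); [lra|].
  destruct (Req_EM_T th (PI / 2)); [lra|].
  simpl. unfold tan.
  set (t := PI / 2 - th).
  assert (Ht : 0 < t < PI) by (unfold t; lra).
  replace (cos th) with (sin t) by
    (rewrite <- cos_shift; f_equal; unfold t; ring).
  replace (sin th) with (cos t) by
    (rewrite <- sin_shift; f_equal; unfold t; ring).
  pose proof PI_RGT_0. pose proof (exp_pos 1) as He1.
  assert (Hs : 0 < sin t) by (apply sin_gt_0; lra).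
  assert (Hst : 1 <= t / sin t).
  { apply Rmult_le_reg_r with (sin t); [lra|].
    replace (t / sin t * sin t) with t by (field; lra).
    pose proof (sin_lt_x t (proj1 Ht)); lra. }
  assert (Hct : t * (cos t / sin t) <= 1).
  { apply Rmult_le_reg_r with (sin t); [lra|].
    replace (t * (cos t / sin t) * sin t) with (t * cos t) by (field; lra).
    pose proof (mul_cos_le_sin t Ht); lra. }
  assert (He : / exp 1 <= exp ((th - PI / 2) * (cos t / sin t))).
  { rewrite <- exp_Ropp. apply exp_le. replace (th - PI / 2) with (- t) by (unfold t; ring). lra. }
  replace (1 - 2 / PI * th) with (2 / PI * t) by (unfold t; field; lra).
  replace (2 / (PI * exp 1)) with (2 / PI * (1 * / exp 1)) by
    (field; lra).
  replace (2 / PI * t / sin t) with (2 / PI * (t / sin t)) by (field; lra).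
  rewrite Rmult_assoc.
  apply Rmult_le_compat_l.
  - apply Rlt_le, Rdiv_lt_0_compat; lra.
  - apply Rmult_le_compat; try lra. apply Rlt_le, Rinv_0_lt_compat, He1.
Qed.

Lemma V_pos (th : R) : - (PI / 2) < th < PI / 2 -> 0 < real (V th).
Proof.
  intros Hth.
  apply Rlt_le_trans with (2 := V_lower th Hth).
  apply Rdiv_lt_0_compat; [lra|].
  apply Rmult_lt_0_compat; [apply PI_RGT_0 | apply exp_pos].
Qed.

Lemma fstar_nonneg (x th : R) : 0 <= fstar x th.
Proof.
  unfold fstar.
  destruct (Rlt_dec (- (PI / 2)) th); [|lra].
  destruct (Rlt_dec th (PI / 2)); [|lra].
  pose proof (V_pos th (conj r r0)).
  repeat apply Rmult_le_pos; try lra; apply Rlt_le, exp_pos.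
Qed.

(** * The two dominating functions *)

Lemma Cst1_eq (l eps : R) : 0 < l -> 0 < eps ->
  Cst1 l eps = exp (2 / (PI * l) * (1 - ln eps)).
Proof.
  intros Hl He. pose proof PI_RGT_0.
  unfold Cst1, Cst, Rpower, msharp.
  rewrite <- exp_plus, ln_mult by lra.
  f_equal. field. lra.
Qed.

Lemma gstar_le_Cst1_fstar (l eps x th : R) : 0 < l ->
  x <= msharp l eps -> gstar l x th <= Cst1 l eps * fstar x th.
Proof.
  intros Hl Hx.
  apply Rmult_le_compat_r; [apply fstar_nonneg|].
  apply Rmult_le_compat_l; [apply Rlt_le, exp_pos|].
  apply exp_le, Rmult_le_compat_r; [|lra].
  apply Rlt_le, Rinv_0_lt_compat, Hl.
Qed.

(** In the variable [u = PI / 2 * (x - meps l eps th)] the square root in the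
    Gaussian density cancels the [sqrt l] of [Cst2]. *)
Lemma gaussian_in_u (l eps x th : R) : 0 < l -> 0 < eps < 1 ->
  Cst2 l eps * (1 / PI) * exp (- (xi l * (x - meps l eps th) ^ 2 / 2))
    * sqrt (2 * xi l / PI)
  = 1 / 2 * exp (- (2 / (PI * l) * ln eps))
    * (1 / (exp 1 * (1 - eps))
       * exp (- (2 / (PI * l) * (PI / 2 * (x - meps l eps th)) ^ 2 / 2))).
Proof.
  intros Hl He. pose proof PI_RGT_0. pose proof (exp_pos 1).
  unfold Cst2, xi, Rpower.
  assert (Hsq : 0 < sqrt l) by (apply sqrt_lt_R0; lra).
  replace (2 * (PI / (2 * l)) / PI) with (/ l) by (field; lra).
  rewrite sqrt_inv.
  set (d := x - meps l eps th).
  replace (PI / (2 * l) * d ^ 2 / 2)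
    with (2 / (PI * l) * (PI / 2 * d) ^ 2 / 2) by (field; lra).
  replace (- (2 / (PI * l)) * ln eps) with (- (2 / (PI * l) * ln eps)) by ring.
  field. lra.
Qed.

Lemma gstar_le_gaussian (l eps x th : R) : 0 < l -> 0 < eps < 1 ->
  msharp l eps < x ->
  gstar l x th <=
    Cst2 l eps * (1 / PI) * exp (- (xi l * (x - meps l eps th) ^ 2 / 2))
      * sqrt (2 * xi l / PI).
Proof.
  intros Hl He Hx. pose proof PI_RGT_0 as HPI. pose proof (exp_pos 1) as He1.
  rewrite gaussian_in_u by assumption.
  set (u := PI / 2 * (x - meps l eps th)).
  assert (Hrhs : 0 <= 1 / 2 * exp (- (2 / (PI * l) * ln eps))
    * (1 / (exp 1 * (1 - eps)) * exp (- (2 / (PI * l) * u ^ 2 / 2)))).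
  { assert (0 < 1 / (exp 1 * (1 - eps))) by
      (apply Rdiv_lt_0_compat; [|apply Rmult_lt_0_compat]; lra).
    repeat apply Rmult_le_pos; try lra; apply Rlt_le, exp_pos. }
  unfold gstar, fstar.
  destruct (Rlt_dec (- (PI / 2)) th) as [H1|]; [|rewrite Rmult_0_r; exact Hrhs].
  destruct (Rlt_dec th (PI / 2)) as [H2|]; [|rewrite Rmult_0_r; exact Hrhs].
  clear Hrhs.
  pose proof (V_lower th (conj H1 H2)) as HV.
  pose proof (V_pos th (conj H1 H2)) as Hv.
  set (v := real (V th)) in *.
  set (b := 2 / (PI * l)).
  set (a := 2 / (eps * l * PI)).
  assert (Hel : 0 < eps * l) by (apply Rmult_lt_0_compat; lra).
  assert (H2PI : 0 < 2 / PI) by (apply Rdiv_lt_0_compat; lra).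
  assert (Ha : 0 < a) by
    (apply Rdiv_lt_0_compat; [|apply Rmult_lt_0_compat]; lra).
  assert (Hb : b = eps * a) by (unfold a, b; field; lra).
  assert (Hb0 : 0 < b) by (rewrite Hb; apply Rmult_lt_0_compat; lra).
  assert (Hlna : ln a = ln (2 / PI) - ln l - ln eps).
  { replace a with (2 / PI / (eps * l)) by (unfold a; field; lra).
    rewrite ln_div, ln_mult by lra. ring. }
  assert (Hlnv : ln (2 / PI) - 1 <= ln v).
  { replace 1 with (ln (exp 1)) by apply ln_exp.
    rewrite <- ln_div by assumption.
    apply ln_le.
    - apply Rdiv_lt_0_compat; assumption.
    - replace (2 / PI / exp 1) with (2 / (PI * exp 1)) by (field; lra).
      exact HV. }
  assert (Hu : u = PI * x / 2 + ln v - ln a).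
  { unfold u, meps. fold v.
    replace (2 / (eps * l * PI * v)) with (a / v) by (unfold a; field; lra).
    rewrite ln_div by assumption. field. lra. }
  (* [msharp] is an upper bound for [meps], since [V th] is at least
     [2 / (PI * e)] and [meps] decreases as [V th] grows. *)
  assert (Hu0 : 0 <= u).
  { unfold msharp in Hx. rewrite ln_mult in Hx by lra.
    apply (Rmult_lt_compat_l (PI / 2)) in Hx; [|lra].
    replace (PI / 2 * (2 / PI * (1 - (ln l + ln eps))))
      with (1 - (ln l + ln eps)) in Hx by (field; lra).
    lra. }
  assert (Hz : exp (PI * x / 2) * v = a * exp u).
  { rewrite <- (exp_ln v) at 1 by assumption.
    rewrite <- (exp_ln a) at 1 by assumption.
    rewrite <- !exp_plus. f_equal. lra. }
  (* The lower bound on [V th] enters here again, through [Hlnv]; it accounts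
     for the [1] in [1 + u]. *)
  assert (Hpre : Cst l * exp (x / l) <= exp (- (b * ln eps)) * exp (b * (1 + u))).
  { unfold Cst, Rpower. rewrite <- !exp_plus. apply exp_le.
    replace (2 / (l * PI)) with b by (unfold b; field; lra).
    replace (x / l) with (b * (PI * x / 2)) by (unfold b; field; lra).
    rewrite Ropp_mult_distr_r, <- !Rmult_plus_distr_l.
    apply Rmult_le_compat_l; lra. }
  rewrite (Rmult_assoc (1 / 2) (exp (PI * x / 2)) v), Hz.
  pose proof (tilted_gamma_le_gaussian eps a u He Ha Hu0) as Hcore.
  rewrite <- Hb in Hcore.
  assert (Hw : 0 <= 1 / 2 * (a * exp u) * exp (- (a * exp u))).
  { pose proof (Rmult_lt_0_compat _ _ Ha (exp_pos u)).
    apply Rmult_le_pos; [lra | apply Rlt_le, exp_pos]. }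
  apply Rle_trans with (1 := Rmult_le_compat_r _ _ _ Hw Hpre).
  replace (exp (- (b * ln eps)) * exp (b * (1 + u))
           * (1 / 2 * (a * exp u) * exp (- (a * exp u))))
    with (1 / 2 * exp (- (b * ln eps))
          * (exp (b * (1 + u)) * (a * exp u * exp (- (a * exp u))))) by ring.
  apply Rmult_le_compat_l; [|exact Hcore].
  apply Rmult_le_pos; [lra | apply Rlt_le, exp_pos].
Qed.

Theorem theorem2 (l eps : R) (hl : 0 < l) (heps : 0 < eps < 1) :
  Cst1 l eps = exp (2 / (PI * l) * (1 - ln eps)) /\
  (forall x th : R,
      x <= msharp l eps -> - (PI / 2) < th <= PI / 2 ->
      gstar l x th <= Cst1 l eps * fstar x th) /\
  (forall x th : R,
      msharp l eps < x -> - (PI / 2) < th <= PI / 2 ->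
      gstar l x th <=
        Cst2 l eps * (1 / PI) * exp (- (xi l * (x - meps l eps th) ^ 2 / 2))
          * sqrt (2 * xi l / PI)).
Proof.
  split; [|split].
  - apply Cst1_eq; lra.
  - intros x th Hx _. apply gstar_le_Cst1_fstar; assumption.
  - intros x th Hx _. apply gstar_le_gaussian; assumption.
Qed.
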